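(* Let $\mathcal{C}\subset\mathbb{R}^n$ be a full-dimensional compact convex set and let $f:\mathbb{R}^n\to\mathbb{R}$ be a smooth convex function with away curvature $C_f^A$. Assume $\mathcal{C}$ satisfies the $\delta$-scaling inequality and $f$ satisfies the $(\theta,c)$-Hölderian error bound on $\mathcal{C}$. Let $\gamma>0$ and let $x_0\in\mathcal{C}$, with proper support $\mathcal{S}_0$, be such that $e^{-\gamma}w(x_0,\mathcal{S}_0)/2\le C_f^A$. Run the scheduled restart scheme for the Fractional Away-step Frank-Wolfe algorithm from $(x_0,\mathcal{S}_0)$ with constant schedule parameters $\gamma_k=\gamma$. Let $T$ be the cumulative number of linear minimization oracle calls over $\mathcal{C}$ (one per inner iteration), and let $x_T$ be the output, with support $\mathcal{S}_T$. Set $r=\frac{1}{1-\theta}$, $w_0=w(x_0,\mathcal{S}_0)$, $\tilde T=T-(|\mathcal{S}_0|-|\mathcal{S}_T|)$, $\mu=(c/\delta)^r$ and $f^*=\min_{\mathcal{C}}f$. Then $$f(x_T)-f^*\le w_0\,\frac{1}{\big(1+\tilde T\,C_\gamma^r\big)^{\frac{1}{2-r}}}\quad\text{when }1\le r<2,$$ $$f(x_T)-f^*\le w_0\exp\Big(-\frac{\gamma}{e^{2\gamma}}\,\frac{\tilde T}{16\,C_f^A\,\mu}\Big)\quad\text{when }r=2,$$ where $$C_\gamma^r=\frac{e^{\gamma(2-r)}-1}{16\,C_f^A\,\mu\,e^{2\gamma}\,w(x_0,\mathcal{S}_0)^{r-2}}.$$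
   Context: $\|\cdot\|$ is a fixed norm on $\mathbb{R}^n$; smooth means differentiable with Lipschitz gradient; $X^*=\operatorname{argmin}_{\mathcal{C}}f$. $\operatorname{Ext}(\mathcal{C})$ is the set of extreme points. A finite $\mathcal{S}\subset\operatorname{Ext}(\mathcal{C})$ is a proper support of $x\in\mathcal{C}$ if $x$ is a convex combination of the elements of $\mathcal{S}$ with all weights positive; $\mathcal{S}_x$ is the set of proper supports of $x$. Define $w(x,\mathcal{S})=\max_{y\in\mathcal{S},z\in\mathcal{C}}\nabla f(x)^T(y-z)$ for $\mathcal{S}\in\mathcal{S}_x$, and $w(x)=\min_{\mathcal{S}\in\mathcal{S}_x}w(x,\mathcal{S})$ (infimum if not attained). Away curvature: $C_f^A=\sup\frac{2}{\eta^2}\big(f(y)-f(x)-\eta\langle\nabla f(x),s-v\rangle\big)$ over $x,s,v\in\mathcal{C}$, $\eta\in(0,1]$, $y=x+\eta(s-v)$. $\delta$-scaling ($\delta>0$): for every differentiable convex $f$ (with its $X^*$ and $w$) and every $x\in\mathcal{C}\setminus X^*$, $w(x)\ge\delta\max_{x^*\in X^*}\langle\nabla f(x),\frac{x-x^*}{\|x-x^*\|}\rangle$. $(\theta,c)$-Hölderian error bound on $\mathcal{C}$ ($\theta\in[0,1/2]$, $c>0$): $\min_{x^*\in X^*}\|x-x^*\|\le c(f(x)-f^* )^\theta$ for all $x\in\mathcal{C}$. Fractional Away-step Frank-Wolfe algorithm. Input: $\gamma>0$, $x_0=\sum_{v\in\mathcal{S}_0}\alpha_0^v v$ with proper support $\mathcal{S}_0$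 and positive weights $\alpha_0^v$. Set $t=0$. While $w(x_t,\mathcal{S}_t)>e^{-\gamma}w(x_0,\mathcal{S}_0)$: take an extreme point $v_t\in\operatorname{argmin}_{v\in\mathcal{C}}\nabla f(x_t)^Tv$ (linear minimization oracle), $d_t^{FW}=v_t-x_t$; take $s_t\in\operatorname{argmax}_{v\in\mathcal{S}_t}\nabla f(x_t)^Tv$, $d_t^{Away}=x_t-s_t$. If $-\nabla f(x_t)^Td_t^{FW}>e^{-\gamma}w(x_0,\mathcal{S}_0)/2$, set $d_t=d_t^{FW}$, $\eta_{\max}=1$; otherwise $d_t=d_t^{Away}$, $\eta_{\max}=\alpha_t^{s_t}/(1-\alpha_t^{s_t})$. Set $x_{t+1}=x_t+\eta_td_t$ with $\eta_t\in\operatorname{argmin}_{\eta\in[0,\eta_{\max}]}f(x_t+\eta d_t)$ (exact line search). Update: for a Frank-Wolfe step, multiply all weights by $1-\eta_t$, add $\eta_t$ to the weight of $v_t$, and set $\mathcal{S}_{t+1}=\{v_t\}$ if $\eta_t=1$, else $\mathcal{S}_t\cup\{v_t\}$; for an away step, multiply all weights by $1+\eta_t$, subtract $\eta_t$ from the weight of $s_t$, and set $\mathcal{S}_{t+1}=\mathcal{S}_t\setminus\{s_t\}$ if $\eta_t=\eta_{\max}$, else $\mathcal{S}_t$. Then $t\leftarrow t+1$. Output: the first iterate with $w(x_t,\mathcal{S}_t)\le e^{-\gamma}w(x_0,\mathcal{S}_0)$, with its support and weights. Scheduled restarts: given $\epsilon>0$, an iteration budget and parameters $(\gamma_k)$,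 repeatedly run the Fractional Away-step Frank-Wolfe algorithm to completion, the $k$-th run using parameter $\gamma_k$ and starting from the iterate, support and weights output by run $k-1$ (the first run starting from $x_0,\mathcal{S}_0$), as long as the strong Wolfe gap $w(\cdot,\cdot)$ of the current point exceeds $\epsilon$ and the cumulative number of iterations is below the budget. Output: the output of the last run.
   Formalization: The bound for 1 ≤ r < 2 is stated only when 1 + T̃·C_γ^r > 0; T̃ can be negative (a full Frank-Wolfe step may discard many vertices), and for a nonpositive base the claimed bound is undefined or, for example at r = 1, false. *)

(* Defs.v *)
From HB Require Import structures.
From mathcomp Require Import all_boot all_order all_algebra finmap.
From mathcomp Require Import all_classical all_reals all_analysis.

Set Implicit Arguments.
Unset Strict Implicit.
Unset Printing Implicit Defensive.

Import Order.TTheory GRing.Theory Num.Theory.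
Import numFieldNormedType.Exports.

Local Open Scope classical_set_scope.
Local Open Scope ring_scope.

Record is_norm (R : realType) (n : nat) (N : 'rV[R]_n -> R) : Prop := IsNorm {
  norm_triangle : forall x y, N (x + y) <= N x + N y;
  norm_scale : forall (a : R) x, N (a *: x) = `|a| * N x;
  norm_definite : forall x, N x = 0 -> x = 0
}.

Definition dotv (R : realType) (n : nat) (u v : 'rV[R]_n) : R :=
  \sum_(i < n) u 0 i * v 0 i.

Definition grad (R : realType) (n : nat) (f : 'rV[R]_n -> R) (x : 'rV[R]_n) :
  'rV[R]_n := \row_i 'D_(delta_mx 0 i) f x.

Definition smooth (R : realType) (n : nat) (N : 'rV[R]_n -> R)
    (f : 'rV[R]_n -> R) : Prop :=
  (forall x, differentiable f x) /\
  exists L : R, forall x y, N (grad f x - grad f y) <= L * N (x - y).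

Definition argmin (R : realType) (T : Type) (A : set T) (g : T -> R) : set T :=
  [set x | A x /\ forall y, A y -> g x <= g y].

Definition argmax (R : realType) (T : Type) (A : set T) (g : T -> R) : set T :=
  [set x | A x /\ forall y, A y -> g y <= g x].

Definition extreme_points (R : realType) (n : nat) (C : set 'rV[R]_n) :
    set 'rV[R]_n :=
  [set x | C x /\ forall (y z : 'rV[R]_n) (t : R), C y -> C z ->
     0 < t -> t < 1 -> x = t *: y + (1 - t) *: z -> y = x /\ z = x].

(* A weight family on [S] is represented by a function on the whole space that
   vanishes off [S], so that a vertex entering the support starts from 0. *)
Definition proper_weights (R : realType) (n : nat) (C : set 'rV[R]_n)
    (x : 'rV[R]_n) (S : {fset 'rV[R]_n}) (a : 'rV[R]_n -> R) : Prop :=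
  [/\ forall v, v \in S -> extreme_points C v,
      forall v, v \in S -> 0 < a v,
      forall v, v \notin S -> a v = 0,
      \sum_(v <- S) a v = 1 &
      x = \sum_(v <- S) a v *: v].

Definition proper_support (R : realType) (n : nat) (C : set 'rV[R]_n)
    (x : 'rV[R]_n) (S : {fset 'rV[R]_n}) : Prop :=
  exists a, proper_weights C x S a.

(* w(x, S) *)
Definition wgap (R : realType) (n : nat) (C : set 'rV[R]_n)
    (f : 'rV[R]_n -> R) (x : 'rV[R]_n) (S : {fset 'rV[R]_n}) : R :=
  sup [set dotv (grad f x) (y - z) | y in [set` S] & z in C].

(* w(x) *)
Definition strong_wolfe_gap (R : realType) (n : nat) (C : set 'rV[R]_n)
    (f : 'rV[R]_n -> R) (x : 'rV[R]_n) : R :=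
  inf [set wgap C f x S | S in [set S | proper_support C x S]].

(* Real-valued: the set is bounded above when C is bounded and f is smooth. *)
Definition away_curvature (R : realType) (n : nat) (C : set 'rV[R]_n)
    (f : 'rV[R]_n -> R) : R :=
  sup [set q | exists x s v y (eta : R),
    [/\ [/\ C x, C s & C v], 0 < eta <= 1, y = x + eta *: (s - v) &
        q = 2 / eta ^+ 2 *
            (f y - f x - eta * dotv (grad f x) (s - v))]].

Definition scaling (R : realType) (n : nat) (N : 'rV[R]_n -> R)
    (C : set 'rV[R]_n) (delta : R) : Prop :=
  forall g : 'rV[R]_n -> R,
    (forall x, differentiable g x) ->
    @convex_function R 'rV[R]_n setT g ->
    forall x, C x -> ~ argmin C g x ->
      delta * sup [set dotv (grad g x) ((N (x - y))^-1 *: (x - y)) |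
                     y in argmin C g]
      <= strong_wolfe_gap C g x.

Definition minval (R : realType) (n : nat) (C : set 'rV[R]_n)
    (f : 'rV[R]_n -> R) : R := inf (f @` C).

Definition error_bound (R : realType) (n : nat) (N : 'rV[R]_n -> R)
    (C : set 'rV[R]_n) (f : 'rV[R]_n -> R) (theta c : R) : Prop :=
  forall x, C x ->
    inf [set N (x - y) | y in argmin C f] <= c * (f x - minval C f) `^ theta.

Record afw_state (R : realType) (n : nat) := AfwState {
  st_point : 'rV[R]_n;
  st_supp : {fset 'rV[R]_n};
  st_weight : 'rV[R]_n -> R
}.

Definition gap (R : realType) (n : nat) (C : set 'rV[R]_n)
    (f : 'rV[R]_n -> R) (p : afw_state R n) : R :=
  wgap C f (st_point p) (st_supp p).

(* One inner iteration, [tau] being the target value of the gap. *)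
Definition afw_step (R : realType) (n : nat) (C : set 'rV[R]_n)
    (f : 'rV[R]_n -> R) (tau : R) (p p' : afw_state R n) : Prop :=
  let: AfwState x A a := p in
  exists v s : 'rV[R]_n, exists eta : R,
    [/\ extreme_points C v,
        argmin C (dotv (grad f x)) v,
        argmax [set` A] (dotv (grad f x)) s &
        let dFW := v - x in
        let dAway := x - s in
        if tau / 2 < - dotv (grad f x) dFW then
          argmin `[0, 1] (fun e : R => f (x + e *: dFW)) eta /\
          p' = AfwState (x + eta *: dFW)
                 (if eta == 1 then [fset v]%fset else (v |` A)%fset)
                 (fun u => (1 - eta) * a u + (if u == v then eta else 0))
        else
          let eta_max := a s / (1 - a s) in
          argmin `[0, eta_max] (fun e : R => f (x + e *: dAway)) eta /\
          p' = AfwState (x + eta *: dAway)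
                 (if eta == eta_max then (A `\ s)%fset else A)
                 (fun u => (1 + eta) * a u - (if u == s then eta else 0))].

(* [afw_loop C f tau p k q]: from [p] the loop stops at [q] after [k]
   iterations. *)
Inductive afw_loop (R : realType) (n : nat) (C : set 'rV[R]_n)
    (f : 'rV[R]_n -> R) (tau : R) :
    afw_state R n -> nat -> afw_state R n -> Prop :=
| afw_stop p : gap C f p <= tau -> afw_loop C f tau p 0 p
| afw_iter p p' k q : tau < gap C f p -> afw_step C f tau p p' ->
    afw_loop C f tau p' k q -> afw_loop C f tau p k.+1 q.

Definition fractional_afw (R : realType) (n : nat) (C : set 'rV[R]_n)
    (f : 'rV[R]_n -> R) (gamma : R) (p : afw_state R n) (k : nat)
    (q : afw_state R n) : Prop :=
  afw_loop C f (expR (- gamma) * gap C f p) p k q.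

(* [restarts C f eps budget gammas k t p T q]: with [k] runs and [t] iterations
   already performed and current state [p], the scheme outputs [q] after [T]
   iterations in total. *)
Inductive restarts (R : realType) (n : nat) (C : set 'rV[R]_n)
    (f : 'rV[R]_n -> R) (eps : R) (budget : nat) (gammas : nat -> R) :
    nat -> nat -> afw_state R n -> nat -> afw_state R n -> Prop :=
| restarts_stop k t p :
    gap C f p <= eps \/ (budget <= t)%N ->
    restarts C f eps budget gammas k t p t p
| restarts_run k t p m p' T q :
    eps < gap C f p -> (t < budget)%N ->
    fractional_afw C f (gammas k) p m p' ->
    restarts C f eps budget gammas k.+1 (t + m) p' T q ->
    restarts C f eps budget gammas k t p T q.

(* Main.v *)
Require Import Defs.
From HB Require Import structures.
From mathcomp Require Import all_boot all_order all_algebra finmap.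
From mathcomp Require Import all_classical all_reals all_analysis.
From mathcomp Require Import ring lra.

Set Implicit Arguments.
Unset Strict Implicit.
Unset Printing Implicit Defensive.

Import Order.TTheory GRing.Theory Num.Theory.
Import numFieldNormedType.Exports.

Local Open Scope classical_set_scope.
Local Open Scope ring_scope.

(** Write [w] for the strong Wolfe gap of the current point with its support,
    [m] for the minimum of [f] on [C] and [K] for [16 C_f^A mu e^(2 gamma)].

    The gap controls the primal gap in two ways.  Convexity gives
    [f x - m <= w] ([primal_le_wgap]).  The scaling inequality and the error
    bound improve this to [f x - m <= mu w^r] ([primal_le_powR_wgap]): for a
    minimizer [y], convexity bounds the slope of [f] along [x - y] from below
    by [(f x - m) / N(x - y)], so [w >= delta (f x - m) / dist(x, argmin)], and
    the error bound turns the distance into a power of [f x - m].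

    Inside one run with target [tau = e^(-gamma) w], the gap splits into a
    Frank-Wolfe part and an away part, so that the chosen direction has slope
    at most [- tau / 2].  By the curvature bound, the step size
    [tau / (2 C_f^A)] decreases [f] by [tau^2 / (8 C_f^A)], and exact line
    search does at least as well, except when an away step is stopped at its
    maximal size; it then removes a vertex from the support.  Since only
    Frank-Wolfe steps add a vertex, and at most one each, the quantity
    (iterations + growth of the support) increases by at most 2 in a step that
    achieves this decrease and does not increase in one that drops a vertex
    ([afw_step_progress]).  The total decrease being at most [mu w^r], a run
    costs at most [K w^(r - 2)] in this measure ([fractional_afw_cost]).

    Across restarts this cost is additive: its sum is [Ttilde].  Each run
    divides [w] by at least [e^gamma], and two elementary recurrences on [w]
    give the sublinear rate for [r < 2] ([restarts_sublinear]) and the linear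
    one for [r = 2] ([restarts_linear]).  The bounds so obtained on the last
    gap are bounds on the primal gap by [primal_le_wgap]. *)

(** * Linear forms and norms on row vectors *)

Section Dot.
Context {R : realType} {n : nat}.
Implicit Types u v g : 'rV[R]_n.

Lemma dotvDr g u v : dotv g (u + v) = dotv g u + dotv g v.
Proof.
by rewrite /dotv -big_split/=; apply: eq_bigr => i _; rewrite mxE mulrDr.
Qed.

Lemma dotvZr g (a : R) u : dotv g (a *: u) = a * dotv g u.
Proof.
by rewrite /dotv big_distrr/=; apply: eq_bigr => i _; rewrite mxE; ring.
Qed.

Lemma dotv0r g : dotv g 0 = 0.
Proof. by rewrite -(scale0r (0 : 'rV[R]_n)) dotvZr mul0r. Qed.

Lemma dotvBr g u v : dotv g (u - v) = dotv g u - dotv g v.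
Proof. by rewrite dotvDr -scaleN1r dotvZr mulN1r. Qed.

Lemma dotv_sumr (I : Type) (s : seq I) g (F : I -> 'rV[R]_n) :
  dotv g (\sum_(i <- s) F i) = \sum_(i <- s) dotv g (F i).
Proof.
elim: s => [|i s IHs]; first by rewrite !big_nil dotv0r.
by rewrite !big_cons dotvDr IHs.
Qed.

Lemma ler_coord_norm u i : `|u 0 i| <= `|u|.
Proof.
rewrite [leRHS]/Num.norm /= mx_normrE.
by apply/bigmax_geP; right; exists (0, i).
Qed.

Lemma dotv_le_norm g u : dotv g u <= (\sum_i `|g 0 i|) * `|u|.
Proof.
rewrite /dotv mulr_suml; apply: ler_sum => i _.
by rewrite (le_trans (ler_norm _))// normrM ler_wpM2l// ler_coord_norm.
Qed.

Lemma compact_dotv_bounded (C : set 'rV[R]_n) g :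
  compact C -> exists M, forall z, C z -> `|dotv g z| <= M.
Proof.
move=> /compact_bounded/ex_strict_bound_gt0[M _ MC].
exists ((\sum_i `|g 0 i|) * M) => z /MC/ltW zM.
have G0 : 0 <= \sum_i `|g 0 i| by apply: sumr_ge0.
apply/ler_normlP; split.
  rewrite -mulN1r -dotvZr scaleN1r.
  by rewrite (le_trans (dotv_le_norm _ _))// normrN ler_wpM2l.
by rewrite (le_trans (dotv_le_norm _ _))// ler_wpM2l.
Qed.

End Dot.

Section Norm.
Context {R : realType} {n : nat} (N : 'rV[R]_n -> R).
Hypothesis normN : is_norm N.
Implicit Types u v x y : 'rV[R]_n.

Lemma is_norm0 : N 0 = 0.
Proof.
by rewrite -(scale0r (0 : 'rV[R]_n)) (norm_scale normN) normr0 mul0r.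
Qed.

Lemma is_normN x : N (- x) = N x.
Proof. by rewrite -scaleN1r (norm_scale normN) normrN normr1 mul1r. Qed.

Lemma is_norm_ge0 x : 0 <= N x.
Proof.
have := norm_triangle normN x (- x); rewrite subrr is_norm0 is_normN; lra.
Qed.

Lemma is_norm_gt0 x : x != 0 -> 0 < N x.
Proof.
by move=> x0; rewrite lt_def is_norm_ge0 andbT; apply: contra_neq x0;
  exact: norm_definite.
Qed.

Lemma is_norm_sum (I : Type) (s : seq I) (F : I -> 'rV[R]_n) :
  N (\sum_(i <- s) F i) <= \sum_(i <- s) N (F i).
Proof.
elim: s => [|i s IHs]; first by rewrite !big_nil is_norm0.
by rewrite !big_cons (le_trans (norm_triangle normN _ _))// lerD2l.
Qed.

Lemma is_norm_le_sup : exists M, forall x, N x <= M * `|x|.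
Proof.
exists (\sum_(i < n) N (delta_mx 0 i)) => x.
rewrite {1}(row_sum_delta x) (le_trans (is_norm_sum _ _))// mulr_suml.
apply: ler_sum => i _.
by rewrite (norm_scale normN) mulrC ler_wpM2l ?is_norm_ge0 ?ler_coord_norm.
Qed.

Lemma is_norm_continuous : continuous N.
Proof.
have [M NM] := is_norm_le_sup.
have M0 : 0 < `|M| + 1 by rewrite ltr_wpDl.
move=> x; apply/(@cvgrPdist_le _ _ _ (nbhs x) _) => e e0.
apply/nbhs_ballP; exists ((`|M| + 1)^-1 * e) => /=.
  by rewrite mulr_gt0// invr_gt0.
move=> y; rewrite -ball_normE /= ltr_pdivlMl// => /ltW xye.
have xy : N (x - y) <= e.
  rewrite (le_trans (NM _))// (le_trans _ xye)//.
  by rewrite ler_wpM2r// (le_trans (ler_norm _))// lerDl.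
have yx : N (y - x) <= e by rewrite -opprB is_normN.
have := norm_triangle normN (x - y) y.
have := norm_triangle normN (y - x) x.
rewrite !subrK ler_norml; lra.
Qed.

(** Half of the equivalence of norms: [N] attains a positive minimum on the
    compact unit sphere of the sup norm. *)
Lemma sup_le_is_norm : exists2 K, 0 < K & forall x, `|x| <= K * N x.
Proof.
pose S := [set u : 'rV[R]_n | `|u| = 1].
have unitS x : x != 0 -> S (`|x|^-1 *: x).
  by move=> x0; rewrite /S/= normrZ normfV normr_id mulVf// normr_eq0.
have [[u0 Su0]|S0] := pselect (S !=set0); last first.
  exists 1 => // x; have [->|x0] := eqVneq x 0.
    by rewrite normr0 mul1r is_norm_ge0.
  by exfalso; apply: S0; exists (`|x|^-1 *: x); exact: unitS.
have compS : compact S.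
  apply: bounded_closed_compact.
    by exists 1; split => // M M1 u /= ->; exact: ltW.
  have -> : S = Num.norm @^-1` [set 1] by [].
  by apply: closed_comp => [x _|]; [exact: norm_continuous|exact: closed_eq].
have [||w] := @EVT_min_rV R n N S _ compS.
- by exists u0.
- by apply: continuous_subspaceT; exact: is_norm_continuous.
rewrite inE => Sw minw.
have Nw0 : 0 < N w.
  apply: is_norm_gt0; apply: contra_eqN Sw => /eqP ->.
  by rewrite normr0 eq_sym oner_eq0.
exists (N w)^-1 => [|x]; first by rewrite invr_gt0.
have [->|x0] := eqVneq x 0; first by rewrite normr0 is_norm0 mulr0.
rewrite ler_pdivlMl// -ler_pdivlMr ?normr_gt0// mulrC.
have := minw _ (mem_set (unitS _ x0)).
by rewrite (norm_scale normN) normfV normr_id.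
Qed.

Lemma dotv_le_is_norm g : exists K, forall x, dotv g x <= K * N x.
Proof.
have [K K0 NK] := sup_le_is_norm.
exists ((\sum_i `|g 0 i|) * K) => x.
rewrite (le_trans (dotv_le_norm _ _))// -mulrA ler_wpM2l//.
exact: sumr_ge0.
Qed.

End Norm.

(** * Convex functions and convex sets *)

Lemma conv_segment (R : realType) (t : R) : 0 <= t <= 1 ->
  exists k : {i01 R}, forall (E : lmodType R) (x y : convex_lmodType E),
    conv k y x = x + t *: (y - x).
Proof.
move=> /andP[t0 t1].
have t01 : Itv.spec (@Itv.num_sem R) (Itv.Real `[0%Z, 1%Z]) t.
  by rewrite /= /Itv.num_sem/= realE t0/= in_itv/= t0 t1.
exists (Itv.mk t01) => E x y.
change (t *: y + (1 - t) *: x = x + t *: (y - x)).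
by rewrite scalerBl scale1r scalerBr addrCA.
Qed.

Section Gradient.
Context {R : realType} {n : nat} (f : 'rV[R]_n -> R).
Hypothesis diff_f : forall x, differentiable f x.
Hypothesis convf : @convex_function R 'rV[R]_n setT f.
Implicit Types x y v : 'rV[R]_n.

Lemma convex_function_segment x y (t : R) : 0 <= t <= 1 ->
  f (x + t *: (y - x)) <= f x + t * (f y - f x).
Proof.
move=> /conv_segment[k kE].
have := convf k (mem_set (I : setT y)) (mem_set (I : setT x)).
rewrite kE => /le_trans; apply; rewrite le_eqVlt; apply/orP; left; apply/eqP.
exact: (kE R^o (f x) (f y)).
Qed.

Lemma derive_grad x v : 'D_v f x = dotv (grad f x) v.
Proof.
rewrite deriveE// {1}(row_sum_delta v) linear_sum/= /dotv.
apply: eq_bigr => i _; rewrite linearZ /= mxE deriveE//.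
by rewrite [LHS]mulrC.
Qed.

(** Convexity bounds the difference quotients of [f] along [y - x] by
    [f y - f x] for steps in ]0, 1]; the gradient is their limit at 0. *)
Lemma grad_le x y : dotv (grad f x) (y - x) <= f y - f x.
Proof.
rewrite -derive_grad.
have cvgD : h^-1 *: ((f \o shift x) (h *: (y - x)) - f x) @[h --> 0^'] -->
    'D_(y - x) f x by exact: diff_derivable.
have {}cvgD := cvg_dnbhs_at_right cvgD.
rewrite -(cvg_lim _ cvgD)//; apply: limr_le.
  by apply/cvg_ex; eexists; exact: cvgD.
near=> h.
have h0 : 0 < h by near: h; exact: nbhs_right_gt.
have h1 : h <= 1 by near: h; exact: nbhs_right_le.
rewrite /= [X in X <= _]/GRing.scale/= ler_pdivrMl// lerBlDl.
by rewrite [h *: _ + x]addrC convex_function_segment// (ltW h0).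
Unshelve. all: by end_near. Qed.

End Gradient.

Section Convexity.
Context {R : realType} {n : nat} (C : set 'rV[R]_n).
Hypothesis convC : @convex_set R 'rV[R]_n C.

Lemma convex_set_segment x y (t : R) : C x -> C y -> 0 <= t <= 1 ->
  C (x + t *: (y - x)).
Proof.
move=> Cx Cy /conv_segment[k kE].
by have := convC k (mem_set Cy) (mem_set Cx); rewrite kE inE.
Qed.

(** Positive weights of arbitrary total mass, normalized afterwards: in this
    form the tail of the sequence satisfies the induction hypothesis. *)
Lemma convex_combination (s : seq 'rV[R]_n) (a : 'rV[R]_n -> R) :
  (forall v, v \in s -> C v) -> (forall v, v \in s -> 0 < a v) ->
  0 < \sum_(v <- s) a v ->
  C ((\sum_(v <- s) a v)^-1 *: \sum_(v <- s) a v *: v).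
Proof.
elim: s => [|u s IHs] sC sa; first by rewrite big_nil ltxx.
have us : u \in u :: s by exact: mem_head.
have [Cu au] := (sC _ us, sa _ us).
rewrite !big_cons => t0.
have [s0|s0] := eqVneq s [::].
  by rewrite s0 !big_nil !addr0 scalerA mulVf ?scale1r// gt_eqF.
have S0 : 0 < \sum_(v <- s) a v.
  case: s s0 sa {IHs sC us t0} => // v s _ sa; rewrite big_cons.
  apply: ltr_wpDr; last by apply: sa; rewrite !inE eqxx orbT.
  rewrite big_seq; apply: sumr_ge0 => w ws; apply/ltW/sa.
  by rewrite !inE ws !orbT.
have {}IHs := IHs (fun v vs => sC _ (mem_behead (vs : v \in behead (u :: s))))
  (fun v vs => sa _ (mem_behead (vs : v \in behead (u :: s)))) S0.
set S := \sum_(v <- s) a v in S0 t0 IHs *; set X := \sum_(v <- s) _ in IHs *.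
have t01 : 0 <= S / (a u + S) <= 1.
  rewrite divr_ge0; [|exact: ltW..].
  by rewrite ler_pdivrMr // mul1r lerDr ltW.
have := convex_set_segment Cu IHs t01; congr C.
apply/rowP => i; rewrite !mxE; field.
by rewrite (gt_eqF S0) (gt_eqF t0).
Qed.

Lemma proper_weights_in x A a : proper_weights C x A a -> C x.
Proof.
move=> [eA a0 _ a1 ->].
have := @convex_combination A a (fun v vA => (eA v vA).1) a0.
by rewrite a1 invr1 scale1r; apply.
Qed.

End Convexity.

(** * Wolfe gaps and the primal gap *)

Section Gaps.
Context {R : realType} {n : nat} (C : set 'rV[R]_n) (f : 'rV[R]_n -> R).
Hypothesis compC : compact C.
Implicit Types (x y z v s : 'rV[R]_n) (A : {fset 'rV[R]_n}).

Lemma le_wgap x A y z : (forall v, v \in A -> C v) -> y \in A -> C z ->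
  dotv (grad f x) (y - z) <= wgap C f x A.
Proof.
move=> AC yA Cz; have [M MC] := compact_dotv_bounded (grad f x) compC.
apply: ub_le_sup; last by exists y => //; exists z.
exists (M + M) => _ [y' y'A [z' Cz' <-]]; rewrite dotvBr.
have := MC _ (AC _ y'A); have := MC _ Cz'.
rewrite !ler_norml; lra.
Qed.

Lemma wgap_le x A s v : argmax [set` A] (dotv (grad f x)) s ->
  argmin C (dotv (grad f x)) v -> wgap C f x A <= dotv (grad f x) (s - v).
Proof.
move=> [sA smax] [Cv vmin]; apply: ge_sup.
  by exists (dotv (grad f x) (s - v)); exists s => //; exists v.
move=> _ [y yA [z Cz <-]]; rewrite !dotvBr.
by rewrite lerB// ?smax ?vmin.
Qed.

(** Averaging [le_wgap] over the support with the weights of [x]. *)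
Lemma le_wgap_point x A a z : proper_weights C x A a -> C z ->
  dotv (grad f x) (x - z) <= wgap C f x A.
Proof.
move=> [eA a0 _ a1 xE] Cz.
have AC v : v \in A -> C v by move=> /eA[].
have -> : x - z = \sum_(v <- A) a v *: (v - z).
  rewrite [in LHS]xE -[in LHS](scale1r z) -a1 scaler_suml -sumrB.
  by apply: eq_bigr => v _; rewrite scalerBr.
rewrite dotv_sumr -[leRHS]mul1r -a1 mulr_suml !big_seq.
apply: ler_sum => v vA; rewrite dotvZr ler_pM2l ?a0//.
exact: le_wgap.
Qed.

Lemma wgap_ge0 x A : proper_support C x A -> 0 <= wgap C f x A.
Proof.
move=> [a [eA a0 _ a1 xE]].
have [E|[y yA]] := fset_0Vmem A.
  by move: a1; rewrite E big_seq_fset0 => /eqP; rewrite eq_sym oner_eq0.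
have AC v : v \in A -> C v by move=> /eA[].
by have := le_wgap x AC yA (AC _ yA); rewrite subrr dotv0r.
Qed.

Lemma strong_wolfe_gap_le x A : proper_support C x A ->
  strong_wolfe_gap C f x <= wgap C f x A.
Proof.
move=> sA; apply: ge_inf; last by exists A.
by exists 0 => _ [B sB <-]; exact: wgap_ge0.
Qed.

Lemma minvalE y : argmin C f y -> minval C f = f y.
Proof.
move=> [Cy ymin]; apply/eqP; rewrite eq_le; apply/andP; split.
  by apply: ge_inf; [exists (f y) => _ [z Cz <-]; exact: ymin|exists y].
by apply: lb_le_inf; [exists (f y); exists y|move=> _ [z Cz <-]; exact: ymin].
Qed.

Hypothesis diff_f : forall x, differentiable f x.

Lemma argmin_nonempty : C !=set0 -> argmin C f !=set0.
Proof.
move=> C0; have cf : {within C, continuous f}.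
  by apply: continuous_subspaceT => x; exact: differentiable_continuous.
have [y] := EVT_min_rV C0 compC cf.
rewrite inE => Cy ymin; exists y; split=> // z Cz.
exact/ymin/mem_set.
Qed.

Lemma minval_le x : C x -> minval C f <= f x.
Proof.
move=> Cx; have [y [Cy ymin]] : argmin C f !=set0.
  by apply: argmin_nonempty; exists x.
by rewrite (minvalE (conj Cy ymin)) ymin.
Qed.

Hypothesis convC : @convex_set R 'rV[R]_n C.
Hypothesis convf : @convex_function R 'rV[R]_n setT f.

Lemma primal_le_wgap x A a : proper_weights C x A a ->
  f x - minval C f <= wgap C f x A.
Proof.
move=> wA; have Cx := proper_weights_in convC wA.
have [y [Cy ymin]] : argmin C f !=set0.
  by apply: argmin_nonempty; exists x.
apply: le_trans (le_wgap_point wA Cy).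
rewrite (minvalE (conj Cy ymin)).
have := grad_le diff_f convf x y; rewrite !dotvBr; lra.
Qed.

Section ErrorBound.
Variables (N : 'rV[R]_n -> R) (delta theta c : R).
Hypothesis normN : is_norm N.
Hypothesis scalC : scaling N C delta.
Hypothesis errb : error_bound N C f theta c.
Hypothesis delta_gt0 : 0 < delta.
Hypothesis c_gt0 : 0 < c.
Hypothesis theta_lt1 : theta < 1.

(** The normalized slope [D] appearing in the scaling inequality satisfies
    [h <= D N(x - y)] for every minimizer [y], hence [h <= D dist(x, argmin)].
    The error bound then gives [h <= D c h^theta], and [D <= w / delta]; it
    remains to solve for [h]. *)
Lemma primal_le_powR_wgap x A a : proper_weights C x A a ->
  f x - minval C f <=
  (c / delta) `^ (1 / (1 - theta)) * wgap C f x A `^ (1 / (1 - theta)).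
Proof.
move=> wA; have Cx := proper_weights_in convC wA.
have sA : proper_support C x A by exists a.
have [y0 ym0] : argmin C f !=set0 by apply: argmin_nonempty; exists x.
set h := f x - minval C f.
have [h_gt0|h_le0] := ltP 0 h; last first.
  by rewrite (le_trans h_le0)// mulr_ge0// powR_ge0.
have xNmin : ~ argmin C f x.
  by move=> xm; move: h_gt0; rewrite /h (minvalE xm) subrr ltxx.
have Nxy y : argmin C f y -> 0 < N (x - y).
  move=> ym; apply: (is_norm_gt0 normN); rewrite subr_eq0.
  by apply: contra_notN xNmin => /eqP ->.
set D := sup [set dotv (grad f x) ((N (x - y))^-1 *: (x - y)) |
                     y in argmin C f].
have leD y : argmin C f y -> h <= D * N (x - y).
  move=> ym; rewrite -ler_pdivrMr ?Nxy//.
  apply: (@le_trans _ _ (dotv (grad f x) ((N (x - y))^-1 *: (x - y)))).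
    rewrite dotvZr mulrC ler_pM2l ?invr_gt0 ?Nxy//.
    rewrite /h (minvalE ym).
    have := grad_le diff_f convf x y; rewrite !dotvBr; lra.
  apply: ub_le_sup; last by exists y.
  (* Normalized slopes are bounded because [dotv g] is bounded for [N],
     so their supremum is an upper bound. *)
  have [K KN] := dotv_le_is_norm normN (grad f x).
  exists K => _ [z zm <-].
  by rewrite dotvZr ler_pdivrMl ?Nxy// mulrC KN.
have D_gt0 : 0 < D.
  by rewrite -(pmulr_lgt0 _ (Nxy _ ym0)) (lt_le_trans h_gt0)// leD.
have hD : h / D <= c * h `^ theta.
  apply: le_trans (errb Cx); apply: lb_le_inf.
    by exists (N (x - y0)); exists y0.
  by move=> _ [y ym <-]; rewrite ler_pdivrMr// mulrC leD.
have Dw : delta * D <= wgap C f x A.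
  by apply: le_trans (scalC diff_f convf Cx xNmin) (strong_wolfe_gap_le sA).
have w_ge0 := wgap_ge0 sA.
have cd_gt0 : 0 < c / delta by rewrite divr_gt0.
have theta'_gt0 : 0 < 1 - theta by rewrite subr_gt0.
have hw : h `^ (1 - theta) <= c / delta * wgap C f x A.
  rewrite powRB; last by rewrite (gt_eqF h_gt0) implybT.
  rewrite (powRr1 (ltW h_gt0)) ler_pdivrMr ?powR_gt0//.
  rewrite ler_pdivrMr// in hD; apply: (le_trans hD).
  rewrite mulrAC ler_wpM2r ?powR_ge0// -mulrA ler_pM2l//.
  by rewrite ler_pdivlMl.
rewrite -(powRM _ (ltW cd_gt0) w_ge0).
have -> : h = (h `^ (1 - theta)) `^ (1 / (1 - theta)).
  by rewrite -powRrM div1r mulfV ?gt_eqF// powRr1// ltW.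
apply: ge0_ler_powR => //; first by rewrite divr_ge0 ?(ltW theta'_gt0).
  by rewrite nnegrE powR_ge0.
by rewrite nnegrE mulr_ge0 ?(ltW cd_gt0).
Qed.

End ErrorBound.
End Gaps.

(** * Updating the weights *)

Section Weights.
Context {R : realType} {n : nat} (C : set 'rV[R]_n).
Implicit Types (x v s : 'rV[R]_n) (A B : {fset 'rV[R]_n}) (a b : 'rV[R]_n -> R).

(** Both kinds of step rescale all the weights by [k] and then add [l] to the
    weight of one vertex [v]; [g] is the identity for the new point and a
    constant for the total mass. *)
Lemma sum_shifted_weights (W : lmodType R) A B a v (k l : R)
    (g : 'rV[R]_n -> W) :
  (A `<=` B)%fset -> v \in B -> (forall u, u \notin A -> a u = 0) ->
  \sum_(u <- B) (k * a u + (if u == v then l else 0)) *: g u =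
  k *: (\sum_(u <- A) a u *: g u) + l *: g v.
Proof.
move=> AB vB aN.
under eq_bigr do rewrite scalerDl.
rewrite big_split/=; congr (_ + _).
  rewrite scaler_sumr -(big_fset_incl _ AB)/=; last first.
    by move=> u _ uA; rewrite aN// mulr0 scale0r.
  by apply: eq_bigr => u _; rewrite scalerA.
rewrite (big_fsetD1 v)//= eqxx big_seq big1 ?addr0// => u.
by rewrite !inE => /andP[/negbTE -> _]; rewrite scale0r.
Qed.

Lemma sum_shifted_scalars A B a v (k l : R) :
  (A `<=` B)%fset -> v \in B -> (forall u, u \notin A -> a u = 0) ->
  \sum_(u <- B) (k * a u + (if u == v then l else 0)) =
  k * (\sum_(u <- A) a u) + l.
Proof.
move=> AB vB aN.
have one D (F : 'rV[R]_n -> R) :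
    \sum_(u <- D) F u = \sum_(u <- D) F u *: (1 : R^o).
  by apply: eq_bigr => u _; rewrite [RHS]mulr1.
rewrite [in LHS]one [in RHS]one.
rewrite (sum_shifted_weights k l (fun=> 1 : R^o) AB vB aN).
by rewrite [l *: 1]mulr1.
Qed.

Lemma proper_weights_fw x A a v (eta : R) : proper_weights C x A a ->
  extreme_points C v -> 0 < eta <= 1 ->
  proper_weights C (x + eta *: (v - x))
    (if eta == 1 then [fset v]%fset else (v |` A)%fset)
    (fun u => (1 - eta) * a u + (if u == v then eta else 0)).
Proof.
move=> [eA a0 aN a1 xE] ev /andP[eta0 eta1].
have [->|eta_neq1] := eqVneq eta 1.
  split.
  - by move=> u; rewrite inE => /eqP ->.
  - by move=> u; rewrite inE => /eqP ->; rewrite eqxx subrr mul0r add0r.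
  - by move=> u; rewrite inE => /negbTE ->; rewrite subrr mul0r add0r.
  - by rewrite big_seq_fset1 eqxx subrr mul0r add0r.
  - rewrite big_seq_fset1 eqxx subrr mul0r add0r !scale1r.
    by rewrite addrC subrK.
have eta_lt1 : 0 < 1 - eta by rewrite subr_gt0 lt_neqAle eta_neq1.
have AB : (A `<=` v |` A)%fset by exact: fsubsetU1.
have vB : v \in (v |` A)%fset by exact: fset1U1.
split.
- by move=> u; rewrite !inE => /orP[/eqP ->//|/eA].
- move=> u; rewrite !inE; have [_|_] /= := eqVneq u v; last first.
    by move=> /a0 au; rewrite addr0 mulr_gt0.
  move=> _; rewrite ltr_wpDl// mulr_ge0 ?(ltW eta_lt1)//.
  by have [/a0/ltW//|/aN ->] := boolP (u \in A).
- move=> u; rewrite !inE negb_or => /andP[/negbTE -> /aN ->].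
  by rewrite mulr0 addr0.
- by rewrite (sum_shifted_scalars _ _ AB vB aN) a1 mulr1 subrK.
- rewrite (sum_shifted_weights _ _ _ AB vB aN) -xE.
  by rewrite scalerBl scale1r scalerBr addrA addrAC.
Qed.

Lemma proper_weights_away x A a s (eta : R) : proper_weights C x A a ->
  s \in A -> a s < 1 -> 0 <= eta <= a s / (1 - a s) ->
  proper_weights C (x + eta *: (x - s))
    (if eta == a s / (1 - a s) then (A `\ s)%fset else A)
    (fun u => (1 + eta) * a u - (if u == s then eta else 0)).
Proof.
move=> [eA a0 aN a1 xE] sA as1 /andP[eta0 eta_max].
have as1' : 0 < 1 - a s by rewrite subr_gt0.
pose b u := (1 + eta) * a u - (if u == s then eta else 0).
have bE u : b u = (1 + eta) * a u + (if u == s then - eta else 0).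
  by rewrite /b; case: ifP; rewrite ?subr0 ?addr0.
have b_gt0 u : u \in A -> u != s -> 0 < b u.
  move=> uA /negbTE us; rewrite bE us addr0 mulr_gt0 ?a0//.
  by rewrite ltr_pwDl.
have bN u : u \notin A -> b u = 0.
  move=> uA; have /negbTE us : u != s by apply: contraNneq uA => ->.
  by rewrite bE us aN// mulr0 addr0.
(* The weight of [s] vanishes exactly at the maximal step size. *)
have bsE : b s = (1 - a s) * (a s / (1 - a s) - eta).
  by rewrite bE eqxx; field; rewrite gt_eqF.
have b1 : \sum_(u <- A) b u = 1.
  under eq_bigr do rewrite bE.
  by rewrite (sum_shifted_scalars _ _ (fsubset_refl A) sA aN) a1 mulr1 addrK.
have bx : x + eta *: (x - s) = \sum_(u <- A) b u *: u.
  under eq_bigr do rewrite bE.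
  rewrite (sum_shifted_weights _ _ _ (fsubset_refl A) sA aN) -xE.
  by rewrite scalerDl scale1r scalerBr scaleNr addrA.
have [eta_eq|eta_neq] := eqVneq eta (a s / (1 - a s)).
  have bs0 : b s = 0 by rewrite bsE -eta_eq subrr mulr0.
  have AsA : (A `\ s `<=` A)%fset by exact: fsubD1set.
  have bAs u : u \in A -> u \notin (A `\ s)%fset -> b u = 0.
    by move=> uA; rewrite !inE uA andbT negbK => /eqP ->.
  split.
  - by move=> u; rewrite !inE => /andP[_ /eA].
  - by move=> u; rewrite !inE => /andP[us uA]; exact: b_gt0.
  - move=> u; have [uA|uA _] := boolP (u \in A); first exact: bAs.
    exact: bN.
  - by apply: etrans b1; apply: (big_fset_incl _ AsA).
  - rewrite bx; apply/esym; apply: (big_fset_incl _ AsA) => u uA uAs.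
    by rewrite -/(b u) bAs// scale0r.
split=> // u uA; rewrite -/(b u).
have [->|us] := eqVneq u s; last exact: b_gt0.
by rewrite bsE mulr_gt0// subr_gt0 lt_neqAle eta_neq.
Qed.

(** A vertex carrying the whole mass would be the point itself; this keeps the
    maximal away step [a s / (1 - a s)] meaningful. *)
Lemma weight_lt1 x A a s : proper_weights C x A a -> s \in A -> x != s ->
  a s < 1.
Proof.
move=> [eA a0 aN a1 xE] sA /eqP; apply: contra_notT; rewrite -leNgt => as1.
have As0 : (A `\ s)%fset = fset0.
  have [//|[t]] := fset_0Vmem (A `\ s)%fset.
  rewrite !inE => /andP[ts tA]; move: a1; rewrite (big_fsetD1 s)//=.
  rewrite (big_fsetD1 t)/= ?inE ?ts ?tA//.
  set S := \sum_(_ <- _) _.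
  have S0 : 0 <= S.
    rewrite /S big_seq; apply: sumr_ge0 => u; rewrite !inE.
    by move=> /and3P[_ _ /a0/ltW].
  by have := a0 t tA => at0 a1; exfalso; clear -as1 S0 at0 a1; lra.
move: a1 xE; rewrite !(big_fsetD1 s sA)/= As0 !big_seq_fset0 !addr0 => ->.
by rewrite scale1r => ->.
Qed.

End Weights.

(** * Progress of the inner iterations *)

Section Step.
Context {R : realType} {n : nat} (C : set 'rV[R]_n) (f : 'rV[R]_n -> R).
Hypothesis convC : @convex_set R 'rV[R]_n C.
Hypothesis convf : @convex_function R 'rV[R]_n setT f.
Implicit Types (x d v s : 'rV[R]_n) (p q : afw_state R n).

Local Notation CfA := (away_curvature C f).

Lemma away_curvature_le x s v (eta : R) : 0 < CfA ->
  C x -> C s -> C v -> 0 < eta <= 1 ->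
  f (x + eta *: (s - v)) <=
  f x + eta * dotv (grad f x) (s - v) + eta ^+ 2 / 2 * CfA.
Proof.
move=> CfA0 Cx Cs Cv /[dup] eta01 /andP[eta0 _].
(* A nonzero supremum is that of a bounded set. *)
have supC : has_sup [set q | exists x s v y (eta : R),
    [/\ [/\ C x, C s & C v], 0 < eta <= 1, y = x + eta *: (s - v) &
        q = 2 / eta ^+ 2 *
            (f y - f x - eta * dotv (grad f x) (s - v))]].
  by apply: contrapT => /sup_out supE; move: CfA0; rewrite /CfA supE ltxx.
have : 2 / eta ^+ 2 * (f (x + eta *: (s - v)) - f x -
    eta * dotv (grad f x) (s - v)) <= CfA.
  by apply: sup_upper_bound => //; exists x, s, v, (x + eta *: (s - v)), eta.
rewrite mulrAC ler_pdivrMr ?exprn_gt0//; lra.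
Qed.

(** The step size [tau / (2 C_f^A)] maximizes the decrease guaranteed by the
    curvature bound for a slope [- tau / 2]; the hypothesis on [tau] makes it
    at most 1. *)
Lemma sufficient_decrease (tau : R) x s v : 0 < tau -> tau / 2 <= CfA ->
  C x -> C s -> C v -> dotv (grad f x) (s - v) <= - (tau / 2) ->
  f (x + (tau / (2 * CfA)) *: (s - v)) + tau ^+ 2 / (8 * CfA) <= f x.
Proof.
move=> tau0 tauC Cx Cs Cv slope.
have CfA0 : 0 < CfA by rewrite (lt_le_trans _ tauC)// divr_gt0.
have e01 : 0 < tau / (2 * CfA) <= 1.
  rewrite divr_gt0 ?mulr_gt0//= ler_pdivrMr ?mulr_gt0//; lra.
have /andP[e0 _] := e01.
have := away_curvature_le CfA0 Cx Cs Cv e01.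
have : tau / (2 * CfA) * dotv (grad f x) (s - v) <=
       tau / (2 * CfA) * - (tau / 2) by rewrite ler_pM2l.
have -> : tau / (2 * CfA) * - (tau / 2) = - 2 * (tau ^+ 2 / (8 * CfA)).
  by field; rewrite gt_eqF.
have -> : (tau / (2 * CfA)) ^+ 2 / 2 * CfA = tau ^+ 2 / (8 * CfA).
  by field; rewrite gt_eqF.
lra.
Qed.

(** A line search on [0, b] that stops before [b] has found a minimizer along
    the whole ray, by convexity.  Hence the step size giving the sufficient
    decrease need not be admissible for the result of the search to beat it. *)
Lemma line_search_ray x d (b eta e : R) :
  argmin `[0, b] (fun e : R => f (x + e *: d)) eta -> eta < b -> 0 <= e ->
  f (x + eta *: d) <= f (x + e *: d).
Proof.
move=> [+ etamin] eta_b e0; rewrite /= in_itv/= => /andP[eta0 _].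
have [eb|be] := leP e b; first by apply: etamin; rewrite /= in_itv/= e0.
have eeta : 0 < e - eta by rewrite subr_gt0 (lt_trans eta_b).
pose t := (b - eta) / (e - eta).
have t0 : 0 < t by rewrite divr_gt0// subr_gt0.
have t1 : t <= 1 by rewrite ler_pdivrMr// mul1r lerB// ltW.
(* [b] is the point at ratio [t] between [eta] and [e]. *)
have := convex_function_segment convf (x + eta *: d) (x + e *: d) (t := t).
rewrite ltW//= t1 => /(_ isT).
have -> : x + eta *: d + t *: (x + e *: d - (x + eta *: d)) = x + b *: d.
  apply/rowP => i; rewrite !mxE /t; field.
  by rewrite gt_eqF.
have : f (x + eta *: d) <= f (x + b *: d).
  by apply: etamin; rewrite /= in_itv/= lexx (le_trans eta0)// ltW.
move=> h1 h2; have := le_trans h1 h2.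
by rewrite lerDl pmulr_rge0// subr_ge0.
Qed.

Definition afw_valid p : Prop :=
  proper_weights C (st_point p) (st_supp p) (st_weight p).

(** The left-hand factor is one iteration plus the growth of the support.  It
    is at most 2 for a step that achieves the sufficient decrease
    [tau^2 / (8 C_f^A)], and 0 for an away step that drops its vertex. *)
Lemma afw_step_progress (tau : R) p p' : 0 < tau -> tau / 2 <= CfA ->
  afw_valid p -> tau < gap C f p -> afw_step C f tau p p' ->
  afw_valid p' /\
  (1 + ((#|` st_supp p' |)%:R - (#|` st_supp p |)%:R)) * tau ^+ 2 <=
  16 * CfA * (f (st_point p) - f (st_point p')).
Proof.
case: p => x A a tau0 tauC; rewrite /afw_valid/= => wA gap_tau.
have CfA0 : 0 < CfA by rewrite (lt_le_trans _ tauC)// divr_gt0.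
have Cx := proper_weights_in convC wA.
have tau2_ge0 : 0 <= tau ^+ 2 by exact: sqr_ge0.
have pay (m y : R) : m <= 2 -> y + tau ^+ 2 / (8 * CfA) <= f x ->
    m * tau ^+ 2 <= 16 * CfA * (f x - y).
  move=> m2 yx; apply: (@le_trans _ _ (2 * tau ^+ 2)); first exact: ler_wpM2r.
  have -> : 2 * tau ^+ 2 = 16 * CfA * (tau ^+ 2 / (8 * CfA)).
    by field; rewrite gt_eqF.
  by rewrite ler_pM2l ?mulr_gt0// lerBrDl.
move=> [v [s [eta [ev vmin smax]]]].
have [Cv _] := vmin; have [sA _] := smax; rewrite /= in sA gap_tau.
have Cs : C s by have [eA _ _ _ _] := wA; have [] := eA _ sA.
case: ifPn => [fw|away] [etamin ->] /=.
  have [] := etamin; rewrite /= in_itv/= => /andP[eta0 eta1] le_eta.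
  have step01 : 0 <= tau / (2 * CfA) <= 1.
    rewrite ltW ?divr_gt0 ?mulr_gt0//=.
    by rewrite ler_pdivrMr ?mulr_gt0// mul1r -ler_pdivrMl// mulrC.
  have dec : f (x + eta *: (v - x)) + tau ^+ 2 / (8 * CfA) <= f x.
    apply: le_trans (sufficient_decrease tau0 tauC Cx Cv Cx _); last first.
      by rewrite lerNr ltW.
    by rewrite lerD2r; apply: le_eta; rewrite /= in_itv.
  (* The new vertex must enter with a positive weight. *)
  have eta_gt0 : 0 < eta.
    rewrite lt_neqAle eta0 andbT; apply/eqP => eta0E.
    move: dec; rewrite -eta0E scale0r addr0 gerDl leNgt divr_gt0//.
      by rewrite exprn_gt0.
    by rewrite mulr_gt0.
  split; first by apply: proper_weights_fw => //; rewrite eta_gt0.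
  apply: pay dec.
  case: ifP => _; first by rewrite cardfs1 addrA lerBlDr lerDl.
  rewrite cardfsU1; case: (v \in A) => /=.
    by rewrite add0n subrr addr0 ler1n.
  by rewrite natrD addrK.
rewrite -leNgt in away.
(* The gap exceeds [tau] and its Frank-Wolfe part is at most [tau / 2]. *)
have slope : dotv (grad f x) (x - s) <= - (tau / 2).
  have := lt_le_trans gap_tau (wgap_le smax vmin).
  move: away; rewrite !dotvBr; lra.
have xs : x != s.
  apply: contraTneq slope => ->.
  by rewrite subrr dotv0r -ltNge oppr_lt0 divr_gt0.
have as1 := weight_lt1 wA sA xs.
have [] := etamin; rewrite /= in_itv/= => /andP[eta0 eta_max] le_eta.
split; first by apply: proper_weights_away => //; rewrite eta0.
case: ifP => [_|/negbT eta_neq].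
  have ->: (#|` A|)%:R = 1 + (#|` (A `\ s)%fset|)%:R :> R.
    by rewrite (cardfsD1 s) sA natrD.
  rewrite addrA subrr mul0r mulr_ge0//.
    by rewrite mulr_ge0// ltW.
  have := le_eta 0; rewrite scale0r addr0 subr_ge0; apply.
  by rewrite /= in_itv/= lexx (le_trans eta0).
apply: pay; first by rewrite subrr addr0 ler1n.
have := sufficient_decrease tau0 tauC Cx Cx Cs slope.
apply: le_trans; rewrite lerD2r.
apply: (line_search_ray etamin); first by rewrite lt_neqAle eta_neq.
by rewrite ltW// divr_gt0// mulr_gt0.
Qed.

Lemma afw_loop_progress (tau : R) p k q : 0 < tau -> tau / 2 <= CfA ->
  afw_valid p -> afw_loop C f tau p k q ->
  [/\ afw_valid q, gap C f q <= tau &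
  (k%:R + ((#|` st_supp q |)%:R - (#|` st_supp p |)%:R)) * tau ^+ 2 <=
  16 * CfA * (f (st_point p) - f (st_point q))].
Proof.
move=> tau0 tauC + loop.
elim: loop => {p k q} [p gp vp|p p' k q gp step _ IH vp].
  by split=> //; rewrite !subrr addr0 mul0r mulr0.
have [vp' le1] := afw_step_progress tau0 tauC vp gp step.
have [vq gq le2] := IH vp'; split=> //.
have := lerD le1 le2; rewrite -mulrDl -mulrDr -natr1.
by congr (_ * _ <= _ * _); ring.
Qed.

End Step.

(** * Restarts *)

(** One run in the sublinear regime: [a], [b] and [s] stand for the powers
    [w^(2 - r)] of the gaps before the run, after it and at the end of the
    scheme, [d] for the cost of the run and [D] for the cost of the rest.
    Dividing by [s], the claim says that [1 / s] has grown by at least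
    [(d + D) (E - 1) / L] since it was [1 / a]; the run contributes
    [d (E - 1) / L <= (E - 1) / a <= 1 / b - 1 / a].  The form without division
    by [b] and [s] covers a vanishing gap. *)
Lemma sublinear_recurrence (R : realType) (E L a b s d D : R) :
  1 <= E -> 0 < L -> 0 < a -> 0 <= b -> 0 <= s -> b * E <= a -> d <= L / a ->
  s * (1 + D * ((E - 1) / L * b)) <= b ->
  s * (1 + (d + D) * ((E - 1) / L * a)) <= a.
Proof.
move=> E1 L0 a0 b0 s0 Eb dL IH.
have [b_gt0|] := ltP 0 b; last first.
  move=> b_le0; have b_eq0 : b = 0 by apply/le_anti; rewrite b_le0.
  move: IH; rewrite b_eq0 !mulr0 addr0 mulr1 => s_le0.
  have -> : s = 0 by apply/le_anti; rewrite s_le0.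
  by rewrite mul0r ltW.
pose x := s * ((E - 1) / L).
have x_ge0 : 0 <= x by rewrite mulr_ge0// divr_ge0 ?subr_ge0 ?(ltW L0).
have {}IH : x * D <= 1 - s / b.
  rewrite -(ler_pM2r b_gt0) mulrBl mul1r divfK ?gt_eqF//.
  by rewrite lerBrDl; apply: le_trans IH; rewrite /x le_eqVlt; apply/orP; left;
    apply/eqP; ring.
have xd : x * d <= s * (E - 1) / a.
  apply: (@le_trans _ _ (x * (L * a^-1))); first by rewrite ler_wpM2l.
  by rewrite /x le_eqVlt; apply/orP; left; apply/eqP; field; rewrite !gt_eqF.
have sE : s * E / a <= s / b.
  by rewrite -mulrA ler_wpM2l// ler_pdivrMr// ler_pdivlMl// mulrC.
rewrite -(ler_pM2r (_ : 0 < a^-1)) ?invr_gt0// mulfV ?gt_eqF//.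
have -> : s * (1 + (d + D) * ((E - 1) / L * a)) / a =
    s / a + (x * d + x * D) by rewrite /x; field; rewrite !gt_eqF.
have : s * (E - 1) / a = s * E / a - s / a by field; rewrite gt_eqF.
lra.
Qed.

Section Restarts.
Context {R : realType} {n : nat} (N : 'rV[R]_n -> R) (C : set 'rV[R]_n)
  (f : 'rV[R]_n -> R) (delta theta c gamma : R).
Hypothesis normN : is_norm N.
Hypothesis convC : @convex_set R 'rV[R]_n C.
Hypothesis compC : compact C.
Hypothesis diff_f : forall x, differentiable f x.
Hypothesis convf : @convex_function R 'rV[R]_n setT f.
Hypothesis delta_gt0 : 0 < delta.
Hypothesis scalC : scaling N C delta.
Hypothesis theta_lt1 : theta < 1.
Hypothesis c_gt0 : 0 < c.
Hypothesis errb : error_bound N C f theta c.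
Hypothesis gamma_ge0 : 0 <= gamma.

Local Notation r := (1 / (1 - theta)).
Local Notation CfA := (away_curvature C f).
Local Notation K := (16 * CfA * (c / delta) `^ r * expR (2 * gamma)).

Lemma gap_ge0 p : afw_valid C p -> 0 <= gap C f p.
Proof. by move=> vp; apply: wgap_ge0 => //; exists (st_weight p). Qed.

(** The decrease of [f] during the run is at most the primal gap at its start,
    itself at most [mu w^r], while [tau^2 = e^(-2 gamma) w^2]. *)
Lemma fractional_afw_cost p m q : 0 < gap C f p ->
  expR (- gamma) * gap C f p / 2 <= CfA ->
  afw_valid C p -> fractional_afw C f gamma p m q ->
  [/\ afw_valid C q, gap C f q <= expR (- gamma) * gap C f p &
  m%:R + ((#|` st_supp q |)%:R - (#|` st_supp p |)%:R) <=
  K * gap C f p `^ (r - 2)].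
Proof.
move=> w_gt0 burn vp run.
have tau_gt0 : 0 < expR (- gamma) * gap C f p by rewrite mulr_gt0 ?expR_gt0.
have CfA_gt0 : 0 < CfA by rewrite (lt_le_trans _ burn)// divr_gt0.
have [vq gq cost] :=
  afw_loop_progress convC convf tau_gt0 burn vp run.
split=> //.
rewrite -(@ler_pM2r _ ((expR (- gamma) * gap C f p) ^+ 2)) ?exprn_gt0//.
apply: (le_trans cost).
have -> : K * gap C f p `^ (r - 2) * (expR (- gamma) * gap C f p) ^+ 2 =
    16 * CfA * ((c / delta) `^ r * gap C f p `^ r).
  rewrite powRB; last by rewrite (gt_eqF w_gt0) implybT.
  rewrite (powR_mulrn 2 (ltW w_gt0)) expRN expRM_natl.
  by field; rewrite !gt_eqF ?expR_gt0.
rewrite ler_pM2l ?mulr_gt0//.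
apply: le_trans (primal_le_powR_wgap compC diff_f convC convf normN scalC errb
  delta_gt0 c_gt0 theta_lt1 vp).
rewrite lerB//; apply: (minval_le compC diff_f).
exact: (proper_weights_in convC vq).
Qed.

(** [P w D z] relates the gap [w] at the start, the total cost [D] and the gap
    [z] at the end.  The induction goes from the last run to the first: the
    remaining runs start from a gap [w'] and cost [D].  The burn-in condition
    persists because the gap decreases, and positivity of [K] comes from the
    burn-in condition as soon as a run is performed. *)
Lemma restarts_cost_ind (P : R -> R -> R -> Prop) :
  (forall w, P w 0 w) ->
  (forall w w' d D z, 0 < K -> 0 < w -> 0 <= w' <= expR (- gamma) * w ->
    d <= K * w `^ (r - 2) -> 0 <= z -> P w' D z -> P w (d + D) z) ->
  forall eps budget k t p T q, 0 <= eps -> afw_valid C p ->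
    expR (- gamma) * gap C f p / 2 <= CfA ->
    restarts C f eps budget (fun=> gamma) k t p T q ->
    afw_valid C q /\
    P (gap C f p)
      (T%:R - t%:R - ((#|` st_supp p |)%:R - (#|` st_supp q |)%:R))
      (gap C f q).
Proof.
move=> P0 PS eps budget k t p T q eps_ge0 + + run.
elim: run => {k t p T q} [k t p _ vp burn|
    k t p m p' T q eps_p _ run _ IH vp burn].
  by split=> //; rewrite !subrr.
have w_gt0 : 0 < gap C f p by exact: le_lt_trans eps_p.
have [vp' gp' cost] := fractional_afw_cost w_gt0 burn vp run.
have CfA_gt0 : 0 < CfA.
  by rewrite (lt_le_trans _ burn)// divr_gt0// mulr_gt0 ?expR_gt0.
have K_gt0 : 0 < K.
  by rewrite !mulr_gt0 ?expR_gt0 ?powR_gt0// divr_gt0.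
have le_gap : gap C f p' <= gap C f p.
  apply: (le_trans gp'); rewrite (ger_pMl _ w_gt0).
  by rewrite -[leRHS]expR0 ler_expR oppr_le0.
have [||vq Pq] := IH; first exact: vp'.
  apply: le_trans burn; apply: ler_wpM2r; first by rewrite invr_ge0.
  by apply: ler_wpM2l; [exact: expR_ge0|exact: le_gap].
split=> //.
have -> : T%:R - t%:R - ((#|` st_supp p |)%:R - (#|` st_supp q |)%:R) =
  m%:R + ((#|` st_supp p' |)%:R - (#|` st_supp p |)%:R) +
  (T%:R - (t + m)%:R - ((#|` st_supp p' |)%:R - (#|` st_supp q |)%:R)) :> R.
  by rewrite natrD; ring.
apply: (PS _ _ _ _ _ K_gt0 w_gt0 _ cost (gap_ge0 vq) Pq).
by rewrite gap_ge0.
Qed.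

Lemma restarts_sublinear eps budget k t p T q :
  r < 2 -> 0 <= eps -> afw_valid C p ->
  expR (- gamma) * gap C f p / 2 <= CfA ->
  restarts C f eps budget (fun=> gamma) k t p T q ->
  afw_valid C q /\
  gap C f q `^ (2 - r) *
    (1 + (T%:R - t%:R - ((#|` st_supp p |)%:R - (#|` st_supp q |)%:R)) *
         ((expR (gamma * (2 - r)) - 1) / (K * gap C f p `^ (r - 2)))) <=
  gap C f p `^ (2 - r).
Proof.
move=> r_lt2 eps_ge0 vp burn run.
have u_gt0 : 0 < 2 - r by rewrite subr_gt0.
pose P w D z := z `^ (2 - r) *
  (1 + D * ((expR (gamma * (2 - r)) - 1) / (K * w `^ (r - 2)))) <= w `^ (2 - r).
apply: (@restarts_cost_ind P _ _ _ _ _ _ _ _ _ eps_ge0 vp burn run).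
  by move=> w; rewrite /P mul0r addr0 mulr1.
move=> {run} w w' d D z K_gt0 w_gt0 /andP[w'_ge0 w'w].
rewrite /P -(opprB 2 r) !powRN => dK z_ge0.
set E := expR (gamma * (2 - r)).
have E_ge1 : 1 <= E.
  by rewrite -[leLHS]expR0 ler_expR mulr_ge0// ltW.
have a_gt0 : 0 < w `^ (2 - r) by exact: powR_gt0.
have Eb : w' `^ (2 - r) * E <= w `^ (2 - r).
  rewrite -ler_pdivlMr ?(lt_le_trans _ E_ge1)// [leRHS]mulrC.
  have -> : E^-1 * w `^ (2 - r) = (expR (- gamma) * w) `^ (2 - r).
    rewrite powRM ?expR_ge0 ?(ltW w_gt0)//; congr (_ * _).
    by rewrite -expRM -expRN mulNr.
  apply: ge0_ler_powR => //; first exact: ltW.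
  by rewrite nnegrE mulr_ge0 ?expR_ge0 ?(ltW w_gt0).
have b_ge0 : 0 <= w' `^ (2 - r) by exact: powR_ge0.
have c_ge0 : 0 <= z `^ (2 - r) by exact: powR_ge0.
have divE y : (E - 1) / (K * (y `^ (2 - r))^-1) = (E - 1) / K * y `^ (2 - r).
  by rewrite invfM invrK mulrA.
by rewrite !divE; exact: sublinear_recurrence.
Qed.

Lemma restarts_linear eps budget k t p T q :
  r = 2 -> 0 <= eps -> afw_valid C p ->
  expR (- gamma) * gap C f p / 2 <= CfA ->
  restarts C f eps budget (fun=> gamma) k t p T q ->
  afw_valid C q /\
  gap C f q <= gap C f p *
    expR (- (gamma *
      ((T%:R - t%:R - ((#|` st_supp p |)%:R - (#|` st_supp q |)%:R)) / K))).
Proof.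
move=> r2 eps_ge0 vp burn run.
pose P w D z := z <= w * expR (- (gamma * (D / K))).
apply: (@restarts_cost_ind P _ _ _ _ _ _ _ _ _ eps_ge0 vp burn run).
  by move=> w; rewrite /P mul0r mulr0 oppr0 expR0 mulr1.
move=> {run} w w' d D z; rewrite /P r2 subrr powRr0 mulr1.
move=> K_gt0 w_gt0 /andP[w'_ge0 w'w] dK z_ge0 /le_trans; apply.
apply: (le_trans (ler_wpM2r (expR_ge0 _) w'w)).
rewrite mulrAC mulrC ler_pM2l// -expRD ler_expR.
rewrite (mulrDl d D) mulrDr opprD lerD2r lerN2.
by rewrite -[leRHS]mulr1 ler_wpM2l// ler_pdivrMr// mul1r.
Qed.

End Restarts.

(* The first bound is stated where its right-hand side is defined: a full
   Frank-Wolfe step may discard many vertices, so Ttilde can be negative and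
   1 + Ttilde * Cgr need not be positive. *)
Theorem theorem5p1 (R : realType) (n : nat) (N : 'rV[R]_n -> R)
    (C : set 'rV[R]_n) (f : 'rV[R]_n -> R) (delta theta c gamma eps : R)
    (x0 : 'rV[R]_n) (S0 : {fset 'rV[R]_n}) (alpha0 : 'rV[R]_n -> R)
    (budget T : nat) (out : afw_state R n)
    (normN : is_norm N)
    (convC : @convex_set R 'rV[R]_n C) (compC : compact C)
    (fulldimC : interior C !=set0)
    (smoothf : smooth N f) (convf : @convex_function R 'rV[R]_n setT f)
    (delta_gt0 : 0 < delta) (scalC : scaling N C delta)
    (theta_ge0 : 0 <= theta) (theta_le : theta <= 1 / 2) (c_gt0 : 0 < c)
    (errb : error_bound N C f theta c)
    (gamma_gt0 : 0 < gamma) (eps_gt0 : 0 < eps)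
    (x0C : C x0) (supp0 : proper_weights C x0 S0 alpha0)
    (burnin : expR (- gamma) * wgap C f x0 S0 / 2 <= away_curvature C f)
    (run : restarts C f eps budget (fun=> gamma) 0 0 (AfwState x0 S0 alpha0)
             T out) :
  let xT := st_point out in
  let ST := st_supp out in
  let r := 1 / (1 - theta) in
  let w0 := wgap C f x0 S0 in
  let Ttilde : R := T%:R - ((#|` S0 |)%:R - (#|` ST |)%:R) in
  let mu := (c / delta) `^ r in
  let CfA := away_curvature C f in
  let Cgr := (expR (gamma * (2 - r)) - 1) /
             (16 * CfA * mu * expR (2 * gamma) * w0 `^ (r - 2)) in
  (1 <= r < 2 -> 0 < 1 + Ttilde * Cgr ->
     f xT - minval C f <= w0 * (1 / (1 + Ttilde * Cgr) `^ (1 / (2 - r)))) /\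
  (r = 2 ->
     f xT - minval C f <=
       w0 * expR (- (gamma / expR (2 * gamma) *
                     (Ttilde / (16 * CfA * mu))))).
Proof.
move=> xT ST r w0 Ttilde mu CfA Cgr.
have [diff_f _] := smoothf.
have theta_lt1 : theta < 1 by lra.
have [gamma_ge0 eps_ge0] : 0 <= gamma /\ 0 <= eps by rewrite !ltW.
have vp : afw_valid C (AfwState x0 S0 alpha0) by exact: supp0.
have w0_ge0 : 0 <= w0 := gap_ge0 f compC vp.
have primal q : afw_valid C q -> f (st_point q) - minval C f <= gap C f q.
  exact: primal_le_wgap.
split=> [/andP[_ r_lt2] B_gt0|r2].
- have [vq le_w0] := restarts_sublinear normN convC compC diff_f convf delta_gt0
    scalC theta_lt1 c_gt0 errb gamma_ge0 r_lt2 eps_ge0 vp burnin run.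
  rewrite subr0 in le_w0.
  apply: (le_trans (primal _ vq)).
  have u_gt0 : 0 < 2 - r by rewrite subr_gt0.
  have powK z : 0 <= z -> (z `^ (2 - r)) `^ (1 / (2 - r)) = z.
    by move=> z0; rewrite -powRrM div1r mulfV ?gt_eqF// powRr1.
  set B := 1 + Ttilde * Cgr in B_gt0 *.
  have -> : w0 * (1 / B `^ (1 / (2 - r))) =
      (w0 `^ (2 - r) / B) `^ (1 / (2 - r)).
    rewrite powRM ?powR_ge0 ?invr_ge0 ?(ltW B_gt0)// powK//; congr (_ * _).
    by rewrite -(powR_inv1 (ltW B_gt0)) -powRrM mulN1r powRN div1r.
  rewrite -[leLHS]powK ?gap_ge0//; apply: ge0_ler_powR.
  + by rewrite divr_ge0 ?(ltW u_gt0).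
  + by rewrite nnegrE powR_ge0.
  + by rewrite nnegrE mulr_ge0 ?powR_ge0// invr_ge0 ltW.
  + by rewrite ler_pdivlMr.
- have [vq le_w0] := restarts_linear normN convC compC diff_f convf delta_gt0
    scalC theta_lt1 c_gt0 errb gamma_ge0 r2 eps_ge0 vp burnin run.
  rewrite subr0 in le_w0.
  have -> : gamma / expR (2 * gamma) * (Ttilde / (16 * CfA * mu)) =
      gamma * (Ttilde / (16 * CfA * mu * expR (2 * gamma))).
    by rewrite (invfM _ (expR (2 * gamma))); ring.
  exact: le_trans (primal _ vq) le_w0.
Qed.
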